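(* Let $1\leq p<2$. There exist constants $a_p>1$ and $c_p>0$ (depending only on $p$) such that for all $n\geq 1$, \[ c_{\nu_n,p}>c_p\,a_p^n . \]
   Context: $B(x,R)$ denotes the Euclidean ball in $\mathbb{R}^n$ centred at $x$ with radius $R$. For a Radon measure $\mu$ on $\mathbb{R}^n$, the associated maximal function is \[ M_\mu g(x)=\sup_{R>0,\ \mu(B(x,R))>0}\frac1{\mu(B(x,R))}\int_{B(x,R)}|g(y)|\,d\mu(y). \] For $1\le p<\infty$, $c_{\mu,p}$ denotes the best (smallest) constant $c$ such that $\mu(\{y\in\mathbb{R}^n: M_\mu g(y)>\lambda\})^{1/p}\leq \frac{c}{\lambda}\|g\|_{L^p(\mu)}$ for all $\lambda>0$ and all $g\in L^p(\mu)$. $\nu_n$ is Lebesgue measure restricted to the unit ball of $\mathbb{R}^n$, i.e. the measure on $\mathbb{R}^n$ whose density is the characteristic function of the Euclidean unit ball centred at the origin. *)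

(* Defs.v *)
From HB Require Import structures.
From mathcomp Require Import all_boot all_order all_algebra.
From mathcomp Require Import all_classical all_reals all_analysis.
From mathcomp Require Import measurable_realfun.
Set Implicit Arguments.
Unset Strict Implicit.
Unset Printing Implicit Defensive.
Import Order.TTheory GRing.Theory Num.Theory.
Import numFieldNormedType.Exports.
Local Open Scope classical_set_scope.
Local Open Scope ring_scope.
Local Open Scope ereal_scope.

(* R^n with its Borel sigma-algebra, generated by the coordinate projections. *)
Notation euclidean R n := (n.-tuple (measurableTypeR R)).

Section lebesgue_measure_Rn.
Context {R : realType}.

Definition consRn n (z : measurableTypeR R * euclidean R n) : euclidean R n.+1 :=
  [tuple of z.1 :: z.2].

Definition unconsRn n (x : euclidean R n.+1) : measurableTypeR R * euclidean R n :=
  (thead x, [tuple of behead x]).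

Lemma consRnK n : cancel (@consRn n) (@unconsRn n).
Proof. by move=> [a t]; congr pair; apply/val_inj. Qed.

Lemma unconsRnK n : cancel (@unconsRn n) (@consRn n).
Proof. by move=> x; rewrite [RHS]tuple_eta; apply/val_inj. Qed.

Lemma measurable_consRn n : measurable_fun [set: _] (@consRn n).
Proof. exact: measurable_cons. Qed.

Lemma measurable_unconsRn n : measurable_fun [set: _] (@unconsRn n).
Proof.
by apply: measurable_fun_pair; [exact: measurable_tnth|exact: measurable_behead].
Qed.

Definition lebesgue_cons n
    (mu : {sigma_finite_measure set (euclidean R n) -> \bar R}) :
    set (euclidean R n.+1) -> \bar R :=
  pushforward (lebesgue_measure \x mu) (@consRn n).

Section lebesgue_cons_measure.
Variables (n : nat) (mu : {sigma_finite_measure set (euclidean R n) -> \bar R}).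

HB.instance Definition _ := Measure.copy (lebesgue_cons mu)
  (measure_function_pushforward__canonical__measure_function_Measure
    (lebesgue_measure \x mu) (@measurable_consRn n)).

Let sigma_finite_lebesgue_cons : sigma_finite setT (lebesgue_cons mu).
Proof.
have /sigma_finiteP[F [FT ndF Foo]] := sigma_finiteT (@lebesgue_measure R).
have /sigma_finiteP[G [GT ndG Goo]] := sigma_finiteT mu.
exists (fun k => @unconsRn n @^-1` (F k `*` G k)).
  rewrite -preimage_bigcup (_ : \bigcup_k _ = setT) ?preimage_setT//.
  apply/seteqP; split=> // -[a t] _.
  have [i _ Fa] : (\bigcup_k F k) a by rewrite -FT.
  have [j _ Gt] : (\bigcup_k G k) t by rewrite -GT.
  exists (maxn i j) => //; split=> /=.
    by move: Fa; exact/subsetPset/ndF/leq_maxl.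
  by move: Gt; exact/subsetPset/ndG/leq_maxr.
move=> k; have [mF Fk] := Foo k; have [mG Gk] := Goo k; split.
  by rewrite -[X in measurable X]setTI; apply: measurable_unconsRn => //;
    exact: measurableX.
rewrite /lebesgue_cons /pushforward -comp_preimage.
rewrite (_ : _ \o _ = idfun); last by apply/funext => z /=; exact: consRnK.
by rewrite preimage_id product_measure1E// lte_mul_pinfty// ge0_fin_numE.
Qed.

HB.instance Definition _ := Measure_isSigmaFinite.Build _ _ _
  (lebesgue_cons mu) sigma_finite_lebesgue_cons.

End lebesgue_cons_measure.

Fixpoint lebesgue_Rn n : {sigma_finite_measure set (euclidean R n) -> \bar R} :=
  if n is m.+1 then lebesgue_cons (lebesgue_Rn m)
  else \d_([tuple] : euclidean R 0).

Lemma lebesgue_Rn_box n (A : 'I_n -> set (measurableTypeR R)) :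
  (forall i, measurable (A i)) ->
  lebesgue_Rn n [set x | forall i, A i (tnth x i)] =
  \prod_(i < n) lebesgue_measure (A i).
Proof.
elim: n A => [|n IHn] A mA.
  by rewrite big_ord0 /= diracE mem_set// => -[].
rewrite big_ord_recl /= /lebesgue_cons /pushforward.
rewrite (_ : _ @^-1` _ = A ord0 `*`
  [set x : euclidean R n | forall i, A (lift ord0 i) (tnth x i)]); last first.
  apply/seteqP; split => [[a t] /= At|[a t] /= [Aa At] i].
    by split=> [|i]; [exact: (At ord0)|have := At (lift ord0 i); rewrite tnthS].
  by have [j ->|->//] := unliftP ord0 i; rewrite tnthS; exact: At.
rewrite product_measure1E//; first by congr (_ * _); exact: IHn.
rewrite (_ : [set _ | _] = \bigcap_(i in [set: 'I_n])
  ((fun x : euclidean R n => tnth x i) @^-1` A (lift ord0 i))); last first.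
  by apply/seteqP; split => [x /= Ax i _|x /= Ax i]; exact: Ax.
apply: fin_bigcap_measurable => // i _.
by rewrite -[X in measurable X]setTI; exact: measurable_tnth.
Qed.

End lebesgue_measure_Rn.

Section maximal_function.
Context {R : realType}.

Definition euclidean_dist n (x y : euclidean R n) : R :=
  Num.sqrt (\sum_(i < n) (tnth x i - tnth y i :> R) ^+ 2)%R.

Definition euclidean_ball n (x : euclidean R n) (r : R) : set (euclidean R n) :=
  [set y | (euclidean_dist x y < r)%R].

Lemma measurable_euclidean_ball n (x : euclidean R n) (r : R) :
  measurable (euclidean_ball x r).
Proof.
have mdist : measurable_fun setT (euclidean_dist x : _ -> R).
  apply: (@measurableT_comp _ _ _ _ _ _ (@Num.sqrt R)) => //.
    apply: continuous_measurable_fun; exact: sqrt_continuous.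
  apply: measurable_sum => i.
  apply: measurable_funX; apply: measurable_funB => //.
  exact: measurable_tnth.
rewrite (_ : euclidean_ball x r = euclidean_dist x @^-1` `]-oo, r[).
  by rewrite -[X in measurable X]setTI; exact: mdist.
by apply/seteqP; split => y /=; rewrite in_itv.
Qed.

(* Balls are open; for a measure that is finite on balls, closed balls give the
   same supremum. *)
Definition maximal_fun n (mu : {measure set (euclidean R n) -> \bar R})
    (g : euclidean R n -> R) (x : euclidean R n) : \bar R :=
  ereal_sup [set (mu (euclidean_ball x r))^-1 *
                 \int[mu]_(y in euclidean_ball x r) `|(g y)%:E|
            | r in [set r : R | (0 < r)%R /\ 0 < mu (euclidean_ball x r)]].

Definition weak_type_bound n (mu : {measure set (euclidean R n) -> \bar R})
    (p c : R) : Prop :=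
  forall (lambda : R) (g : euclidean R n -> R),
    (0 < lambda)%R -> g \in Lfun mu p%:E ->
    mu [set y | lambda%:E < maximal_fun mu g y] `^ p^-1 <=
    (c / lambda)%:E * 'N[mu]_p%:E[EFin \o g].

(* The infimum is a minimum as soon as some bound holds, and +oo otherwise; the
   restriction [0 <= c] only matters when [mu] is zero. *)
Definition best_constant n (mu : {measure set (euclidean R n) -> \bar R})
    (p : R) : \bar R :=
  ereal_inf [set c%:E | c in [set c : R | (0 <= c)%R /\ weak_type_bound mu p c]].

Definition unit_ball_measure n : {measure set (euclidean R n) -> \bar R} :=
  mrestr (lebesgue_Rn n)
    (measurable_euclidean_ball ([tuple of nseq n 0%R] : euclidean R n) 1).

End maximal_function.

(* Main.v *)
(* Let [g] be the indicator of the ball [B(0, r)] with [r] slightly less than [1]. For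
   every [x] with [|x|] close to [1], the ball [B(x, R0)] with [R0 ^ 2 = 2 - 2 h] meets
   the unit ball inside a ball of radius [rho], [rho] close to [sqrt (1 - h ^ 2)], while
   it meets [B(0, r)] in a lens whose volume is, up to a factor independent of [n], at
   least that of a ball of radius [s], with [s ^ 2] close to [r ^ 2 - k ^ 2], where [k]
   is the distance from the origin to the hyperplane of intersection of the two spheres.
   So [M g] exceeds a constant times [(s / rho) ^ n] on a shell carrying a fixed
   proportion of the mass, and the best constant is at least a constant times
   [(s / (rho * r `^ p^-1)) ^ n]. For [r] close to [1], the base of this power is larger
   than [1] as soon as [h > p - 1], and [h = p / 2 < 1] is such a choice for [p < 2]. *)

Require Import Defs.
From mathcomp Require Import all_boot all_order all_algebra.
From mathcomp Require Import all_classical all_reals all_analysis.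
From mathcomp Require Import measurable_realfun ring lra.
Set Implicit Arguments.
Unset Strict Implicit.
Unset Printing Implicit Defensive.
Import Order.TTheory GRing.Theory Num.Theory.
Local Open Scope ring_scope.

(** * Change of variables under dilations and translations *)

Section affine.
Context {R : realType}.
Local Open Scope classical_set_scope.

Definition affine_map n (c : R) (v x : euclidean R n) : euclidean R n :=
  [tuple (c * (tnth x i : R) + (tnth v i : R) : R) | i < n].

Lemma affine_mapE n (c : R) (v x : euclidean R n) i :
  tnth (affine_map c v x) i = c * (tnth x i : R) + (tnth v i : R) :> R.
Proof. by rewrite tnth_mktuple. Qed.

Lemma measurable_affine_map n (c : R) (v : euclidean R n) :
  measurable_fun setT (affine_map c v).
Proof.
apply/measurable_fun_tnthP => i.
rewrite (_ : _ \o _ = fun x : euclidean R n => c * (tnth x i : R) + (tnth v i : R)); last first.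
  by apply/funext => x /=; rewrite affine_mapE.
apply: measurable_funD => //; apply: measurable_funM => //.
exact: measurable_tnth.
Qed.

Lemma measurable_preimageT d d' (T : measurableType d) (U : measurableType d')
    (f : T -> U) (A : set U) :
  measurable_fun setT f -> measurable A -> measurable (f @^-1` A).
Proof. by move=> mf mA; rewrite -[X in measurable X]setTI; exact: mf. Qed.

(** The pushforward under [x |-> c * x + a], scaled by [c], gives half-open intervals their length,
    so uniqueness of Lebesgue measure applies. *)
Lemma lebesgue_measure_affine (c a : R) (A : set (measurableTypeR R)) :
  0 < c -> measurable A ->
  (lebesgue_measure A =
   c%:E * lebesgue_measure ((fun x : R => c * x + a)%R @^-1` A))%E.
Proof.
move=> c0 mA.
pose f (x : measurableTypeR R) : measurableTypeR R := (c * (x : R) + a : R).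
have mf : measurable_fun setT f.
  by apply: measurable_funD => //; apply: measurable_funM.
pose m' : {measure set _ -> \bar R} := mscale (NngNum (ltW c0))
  (measure_function_pushforward__canonical__measure_function_Measure
    lebesgue_measure mf).
rewrite (@lebesgue_measure_unique R m')//.
move=> _ [[x y] _ <-]/=.
rewrite /mscale/= /pushforward/=.
rewrite (_ : f @^-1` _ = `](x - a) / c, (y - a) / c]).
  rewrite !lebesgue_measure_itv/= !lte_fin ltr_pM2r ?invr_gt0// ltrD2r.
  case: ifPn => _; last by rewrite mule0.
  by rewrite -!EFinB -EFinM; congr EFin; field; rewrite gt_eqF.
by apply/seteqP; split => z /=; rewrite !in_itv/= /f ltr_pdivrMr// ler_pdivlMr//
  ltrBlDr lerBrDr [c * _]mulrC.
Qed.

Lemma lebesgue_RnS n (A : set (euclidean R n.+1)) :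
  lebesgue_Rn n.+1 A = (lebesgue_measure \x lebesgue_Rn n)%E (@consRn R n @^-1` A).
Proof. by []. Qed.

(** Induction on the dimension. The pushforward [m'] has the right value on rectangles, by the
    one-dimensional case and the induction hypothesis, so uniqueness of the product measure gives
    equality on all measurable sets. *)
Lemma lebesgue_Rn_affine n (c : R) (v : euclidean R n) (A : set (euclidean R n)) :
  0 < c -> measurable A ->
  (lebesgue_Rn n A =
   (c ^+ n)%:E * lebesgue_Rn n (affine_map c v @^-1` A))%E.
Proof.
move=> c0; elim: n v A => [|n IHn] v A mA.
  rewrite expr0 mul1e (_ : affine_map c v @^-1` A = A)//.
  by apply/funext => x; rewrite /preimage/= (tuple0 (affine_map _ _ _)) (tuple0 x).
pose f (z : measurableTypeR R * euclidean R n) : measurableTypeR R * euclidean R n :=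
  ((c * (z.1 : R) + (thead v : R) : R), affine_map c [tuple of behead v] z.2).
have mf : measurable_fun setT f.
  apply: measurable_fun_pair.
    apply: measurable_funD => //; apply: measurable_funM => //.
  apply: measurableT_comp => //; exact: measurable_affine_map.
have cn0 : 0 <= c ^+ n.+1 by rewrite exprn_ge0// ltW.
pose m' : {measure set _ -> \bar R} := mscale (NngNum cn0)
  (measure_function_pushforward__canonical__measure_function_Measure
    (lebesgue_measure \x lebesgue_Rn n)%E mf).
have m'E X : measurable X -> (lebesgue_measure \x lebesgue_Rn n)%E X = m' X.
  apply: product_measure_unique => B C mB mC; rewrite /m' /= /mscale/= /pushforward.
  rewrite (_ : f @^-1` _ = ((fun x : R => c * x + (thead v : R)) @^-1` B) `*`
    (affine_map c [tuple of behead v] @^-1` C))//.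
  rewrite product_measure1E; last 2 first.
  + have mg : measurable_fun setT
        (fun x : measurableTypeR R => (c * (x : R) + thead v : R) : measurableTypeR R).
      by apply: measurable_funD => //; apply: measurable_funM.
    exact: measurable_preimageT mg mB.
  + exact: measurable_preimageT (@measurable_affine_map n c _) mC.
  rewrite (lebesgue_measure_affine (thead v) c0 mB) (IHn [tuple of behead v] C mC).
  by rewrite exprS EFinM muleACA.
have mcA : measurable (@consRn R n @^-1` A).
  exact: measurable_preimageT (@measurable_consRn R n) mA.
have fE : f @^-1` (@consRn R n @^-1` A) = @consRn R n @^-1` (affine_map c v @^-1` A).
  have E z : consRn (f z) = affine_map c v (consRn z).
    case: z => x t; apply: eq_from_tnth => i.
    rewrite affine_mapE; have [j ->|->] := unliftP ord0 i.
      rewrite !tnthS affine_mapE; congr (_ + _).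
      by rewrite [in RHS](tuple_eta v) tnthS.
    by rewrite [in RHS](tuple_eta v).
  by apply/funext => z; rewrite /preimage /= E.
by rewrite !lebesgue_RnS (m'E _ mcA) -fE.
Qed.

End affine.

(** * Volumes of Euclidean balls *)

Section balls.
Context {R : realType}.
Local Open Scope classical_set_scope.

Definition origin n : euclidean R n := [tuple of nseq n 0%R].

Definition normsq n (x : euclidean R n) : R := \sum_(i < n) (tnth x i : R) ^+ 2.

Definition dotp n (x y : euclidean R n) : R :=
  \sum_(i < n) (tnth x i : R) * (tnth y i : R).

Lemma normsq_ge0 n (x : euclidean R n) : 0 <= normsq x.
Proof. by apply: sumr_ge0 => i _; exact: sqr_ge0. Qed.

Lemma tnth_origin n (i : 'I_n) : tnth (origin n) i = 0 :> R.
Proof. by rewrite (tnth_nth 0) nth_nseq ltn_ord. Qed.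

Lemma euclidean_ballE n (x y : euclidean R n) (r : R) : 0 < r ->
  euclidean_ball x r y <->
  \sum_(i < n) ((tnth x i : R) - (tnth y i : R)) ^+ 2 < r ^+ 2.
Proof.
move=> r0; rewrite /euclidean_ball /euclidean_dist /=.
by rewrite -[X in _ < X]ger0_norm ?ltW// -sqrtr_sqr ltr_sqrt// exprn_gt0.
Qed.

Lemma euclidean_ball0E n (y : euclidean R n) (r : R) : 0 < r ->
  euclidean_ball (origin n) r y <-> normsq y < r ^+ 2.
Proof.
move=> r0; rewrite euclidean_ballE//.
rewrite (_ : \sum_(i < n) _ = normsq y)//; apply: eq_bigr => i _.
by rewrite tnth_origin sub0r sqrrN.
Qed.

Lemma subset_euclidean_ball n (x : euclidean R n) (r s : R) : r <= s ->
  euclidean_ball x r `<=` euclidean_ball x s.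
Proof. by move=> rs y /= /lt_le_trans; apply. Qed.

Lemma lebesgue_Rn_ball n (x : euclidean R n) (r : R) : 0 < r ->
  (lebesgue_Rn n (euclidean_ball x r) =
   (r ^+ n)%:E * lebesgue_Rn n (euclidean_ball (origin n) 1))%E.
Proof.
move=> r0; rewrite (lebesgue_Rn_affine x r0 (measurable_euclidean_ball x r)).
congr (_ * lebesgue_Rn n _)%E; apply/seteqP.
suff E y : euclidean_ball x r (affine_map r x y) <-> euclidean_ball (origin n) 1 y.
  by split => y /E.
rewrite euclidean_ballE// euclidean_ball0E//.
rewrite (_ : \sum_(i < n) _ = r ^+ 2 * normsq y).
  by rewrite -[X in _ < X <-> _]mulr1 ltr_pM2l ?exprn_gt0// expr1n.
rewrite mulr_sumr; apply: eq_bigr => i _; rewrite affine_mapE.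
by ring.
Qed.

Lemma lebesgue_Rn_translate n (v : euclidean R n) (A : set (euclidean R n)) :
  measurable A -> lebesgue_Rn n (affine_map 1 v @^-1` A) = lebesgue_Rn n A.
Proof.
by move=> mA; rewrite (lebesgue_Rn_affine v ltr01 mA) expr1n mul1e.
Qed.

Lemma lebesgue_Rn_cube n (a : R) : 0 < a ->
  lebesgue_Rn n [set x | forall i, `]-a, a[ (tnth x i : R)] = ((2 * a) ^+ n)%:E.
Proof.
move=> a0.
rewrite (@lebesgue_Rn_box R n (fun=> `]-a, a[)); last by move=> i; exact: measurable_itv.
rewrite (eq_bigr (fun=> (2 * a)%:E)).
  by rewrite prodEFin prodr_const card_ord.
move=> i _; rewrite lebesgue_measure_itv/= lte_fin gtrN// -EFinB opprK.
by rewrite -mulr2n mulr_natl.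
Qed.

Lemma measurable_cube n (a : R) :
  measurable [set x : euclidean R n | forall i, `]-a, a[ (tnth x i : R)].
Proof.
rewrite (_ : [set _ | _] = \bigcap_(i in [set: 'I_n])
  ((fun x : euclidean R n => tnth x i) @^-1` `]-a, a[)); last first.
  by apply/seteqP; split => [x /= Ax i _|x /= Ax i]; exact: Ax.
apply: fin_bigcap_measurable => // i _.
apply: measurable_preimageT (measurable_tnth i) _; exact: measurable_itv.
Qed.

Lemma lebesgue_Rn_unit_ball_fin_num n :
  lebesgue_Rn n (euclidean_ball (origin n) 1) \is a fin_num.
Proof.
rewrite ge0_fin_numE//.
have cube : lebesgue_Rn n [set x | forall i, `]-1, 1[ (tnth x i : R)] \is a fin_num.
  by rewrite lebesgue_Rn_cube.
rewrite ge0_fin_numE// in cube; apply: le_lt_trans cube.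
apply: le_measure; rewrite ?inE.
- exact: measurable_euclidean_ball.
- exact: measurable_cube.
- move=> x /euclidean_ball0E-/(_ ltr01); rewrite expr1n => x1 i.
  have xi : (tnth x i : R) ^+ 2 < 1.
    apply: le_lt_trans x1; rewrite /normsq (bigD1 i)//= lerDl.
    by apply: sumr_ge0 => j _; exact: sqr_ge0.
  by rewrite /= in_itv/=; apply/andP; split; nra.
Qed.

(** The cube of half-side [1 / (n + 1)] lies in the unit ball: each squared coordinate is at most
    [1 / (n + 1)], and there are only [n] of them. *)
Lemma lebesgue_Rn_unit_ball_gt0 n :
  (0 < lebesgue_Rn n (euclidean_ball (origin n) 1))%E.
Proof.
have n0 : (0 : R) < n.+1%:R^-1 by rewrite invr_gt0.
apply: (@lt_le_trans _ _
  (lebesgue_Rn n [set x | forall i, `]-(n.+1%:R^-1), n.+1%:R^-1[ (tnth x i : R)])).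
  by rewrite lebesgue_Rn_cube// lte_fin exprn_gt0// mulr_gt0.
apply: le_measure; rewrite ?inE.
- exact: measurable_cube.
- exact: measurable_euclidean_ball.
- move=> x cx; apply/euclidean_ball0E => //; rewrite expr1n.
  apply: (@le_lt_trans _ _ (\sum_(i < n) n.+1%:R^-1)).
    apply: ler_sum => i _; have := cx i; rewrite /= in_itv/= => xi.
    have sqr_le (y c : R) : - c < y < c -> c <= 1 -> y ^+ 2 <= c.
      by move=> /andP[? ?] ?; nra.
    by apply: sqr_le xi _; rewrite invf_le1// ler1n.
  by rewrite sumr_const card_ord -[_ *+ n]mulr_natl ltr_pdivrMr// mul1r ltr_nat.
Qed.

(** Its value is never computed: positivity is enough, as the volume cancels from the final
    estimate. *)
Definition ball_volume n : R := fine (lebesgue_Rn n (euclidean_ball (origin n) 1)).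

Lemma ball_volume_gt0 n : 0 < ball_volume n.
Proof.
apply: fine_gt0; rewrite lebesgue_Rn_unit_ball_gt0/=.
by rewrite -ge0_fin_numE// lebesgue_Rn_unit_ball_fin_num.
Qed.

Lemma lebesgue_Rn_ballE n (x : euclidean R n) (r : R) : 0 < r ->
  lebesgue_Rn n (euclidean_ball x r) = (r ^+ n * ball_volume n)%:E.
Proof.
by move=> r0; rewrite lebesgue_Rn_ball// EFinM fineK// lebesgue_Rn_unit_ball_fin_num.
Qed.

(** * Caps and lenses: intersections of two balls *)

Definition scalev n (a : R) (x : euclidean R n) : euclidean R n :=
  [tuple (a * (tnth x i : R) : R) | i < n].

(* Stewart's identity for the point [h x] of the segment from [0] to [x]. *)
Lemma dist_scalevE n (h : R) (x y : euclidean R n) :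
  \sum_(i < n) ((tnth (scalev h x) i : R) - (tnth y i : R)) ^+ 2 =
  (1 - h) * normsq y + h * \sum_(i < n) ((tnth x i : R) - (tnth y i : R)) ^+ 2
  - h * (1 - h) * normsq x.
Proof.
rewrite /normsq !mulr_sumr -big_split/= -sumrB; apply: eq_bigr => i _.
by rewrite tnth_mktuple; ring.
Qed.

(** Stewart's identity bounds the squared distance from [h x] to [y] by [(1 - h) + h * (2 - 2 * h) -
    h * (1 - h) * t], which is [(1 - h) * (1 + 2 * h - h * t)]. *)
Lemma ball_cap_subset n (h rho r t : R) (x : euclidean R n) :
  0 < h < 1 -> 0 < rho -> 0 < r -> r ^+ 2 = 2 - 2 * h ->
  t <= normsq x -> (1 - h) * (1 + 2 * h - h * t) <= rho ^+ 2 ->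
  euclidean_ball x r `&` euclidean_ball (origin n) 1 `<=`
  euclidean_ball (scalev h x) rho.
Proof.
move=> /andP[h0 h1] rho0 r0 r2 tx le_rho y [/euclidean_ballE-/(_ r0)].
rewrite r2; set d := \sum_(i < n) _ => d_lt.
move/euclidean_ball0E => /(_ ltr01); rewrite expr1n => y1.
apply/euclidean_ballE => //; apply: lt_le_trans le_rho.
rewrite dist_scalevE -/d.
have : h * (1 - h) * t <= h * (1 - h) * normsq x.
  by rewrite ler_pM2l// mulr_gt0// subr_gt0.
have : h * d < h * (2 - 2 * h) by rewrite ltr_pM2l.
have : (1 - h) * normsq y < (1 - h) * 1 by rewrite ltr_pM2l// subr_gt0.
by nra.
Qed.

(** Cauchy-Schwarz for a unit vector: [y] minus its projection on [e] has nonnegative squared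
    norm. *)
Lemma dotp_sqr_le n (e y : euclidean R n) : normsq e = 1 ->
  dotp y e ^+ 2 <= normsq y.
Proof.
move=> e1; have E D : \sum_(i < n) ((tnth y i : R) - D * (tnth e i : R)) ^+ 2 =
    normsq y - 2 * D * dotp y e + D ^+ 2 * normsq e.
  rewrite /normsq /dotp !mulr_sumr -sumrB -big_split/=.
  by apply: eq_bigr => i _; ring.
have : 0 <= \sum_(i < n) ((tnth y i : R) - dotp y e * (tnth e i : R)) ^+ 2.
  by apply: sumr_ge0 => i _; exact: sqr_ge0.
by rewrite E e1; lra.
Qed.

(** The translation takes the slab of height [a] to height [k]. With [w = dotp z e - a] in [[0, d[],
    the new squared distance to [t e] is [normsq z + (k - t) ^ 2 - a ^ 2 + 2 * (k - a - t) * w];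
    here [- a ^ 2] only helps, and the last term is at most [4 * d] because [k - a - t <= 2]. *)
Lemma slab_shift n (e z : euclidean R n) (s k t r a d : R) :
  0 < s -> 0 < r -> normsq e = 1 -> 0 <= k <= 1 -> 0 <= t <= 1 -> -1 <= a <= 1 ->
  normsq z < s ^+ 2 -> a <= dotp z e < a + d ->
  s ^+ 2 + (k - t) ^+ 2 + 4 * d <= r ^+ 2 ->
  euclidean_ball (scalev t e) r (affine_map 1 (scalev (k - a) e) z).
Proof.
move=> s0 r0 e1 /andP[k0 k1] /andP[t0 t1] /andP[a0 a1] zs /andP[az za] le_r.
apply/euclidean_ballE => //; apply: lt_le_trans le_r.
have -> : \sum_(i < n) ((tnth (scalev t e) i : R) -
    (tnth (affine_map 1 (scalev (k - a) e) z) i : R)) ^+ 2 =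
    normsq z + 2 * (k - a - t) * dotp z e + (k - a - t) ^+ 2 * normsq e.
  rewrite /normsq /dotp !mulr_sumr -!big_split/=; apply: eq_bigr => i _.
  by rewrite affine_mapE !tnth_mktuple; ring.
rewrite e1 mulr1.
have : (k - a - t) * (dotp z e - a) <= 2 * d.
  by apply: (@le_trans _ _ (2 * (dotp z e - a))); nra.
have := sqr_ge0 a.
by nra.
Qed.

Lemma measurable_dotp n (e : euclidean R n) :
  measurable_fun setT (fun z : euclidean R n => dotp z e : R).
Proof.
apply: measurable_sum => i; apply: measurable_funM => //.
exact: measurable_tnth.
Qed.

(* Cut the ball of radius [s] into [N] slabs orthogonal to [e]; each of them can be
   translated into the lens. *)
Lemma ball_le_lens n (e : euclidean R n) (N : nat) (s k t r r' : R) :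
  normsq e = 1 -> (0 < N)%N -> 0 < s <= 1 -> 0 <= k <= 1 -> 0 <= t <= 1 ->
  0 < r -> 0 < r' ->
  s ^+ 2 + k ^+ 2 + 8 / N%:R <= r ^+ 2 ->
  s ^+ 2 + (k - t) ^+ 2 + 8 / N%:R <= r' ^+ 2 ->
  (lebesgue_Rn n (euclidean_ball (origin n) s) <=
   N%:R%:E * lebesgue_Rn n (euclidean_ball (origin n) r `&`
                            euclidean_ball (scalev t e) r'))%E.
Proof.
move=> e1 N0 /andP[s0 s1] k01 t01 r0 r'0 sr sr'.
set L := _ `&` _.
have mL : measurable L by apply: measurableI; exact: measurable_euclidean_ball.
have NR0 : (0 : R) < N%:R by rewrite ltr0n.
(* Lower ends of [N] slabs of width [2 / N] covering [[-1, 1[]. With [d = 2 / N], the error [4 * d]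
   of the shift is the [8 / N] of the hypotheses. *)
pose a (j : nat) : R := -1 + 2 * j%:R / N%:R.
pose S (j : nat) := euclidean_ball (origin n) s `&`
  ((fun z : euclidean R n => dotp z e) @^-1` `[a j, a j.+1[).
have aS j : a j.+1 = a j + 2 / N%:R.
  by rewrite /a -natr1; field; rewrite gt_eqF.
have mS j : measurable (S j).
  apply: measurableI; first exact: measurable_euclidean_ball.
  apply: measurable_preimageT (measurable_dotp e) _; exact: measurable_itv.
have SL j : (j < N)%N -> (lebesgue_Rn n (S j) <= lebesgue_Rn n L)%E.
  move=> jN; rewrite -(lebesgue_Rn_translate (scalev (k - a j) e) mL).
  apply: le_measure; rewrite ?inE//.
    exact: measurable_preimageT (measurable_affine_map _ _) mL.
  move=> z [/euclidean_ball0E-/(_ s0) zs]; rewrite /= in_itv/= aS => zj.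
  have aj : -1 <= a j <= 1.
    rewrite /a; have : 0 <= j%:R / N%:R :> R by rewrite divr_ge0.
    have : j%:R / N%:R <= 1 :> R by rewrite ler_pdivrMr// mul1r ler_nat ltnW.
    by move=> ? ?; apply/andP; split; lra.
  have d8 : 8 / N%:R = 4 * (2 / N%:R) :> R by ring.
  split.
    (* The ball centred at the origin is the case [t = 0]. *)
    have := @slab_shift n e z s k 0 r (a j) (2 / N%:R) s0 r0 e1 k01.
    rewrite lexx ler01 subr0 -d8 => /(_ isT aj zs zj sr).
    rewrite (_ : scalev 0 e = origin n)//.
    by apply: eq_from_tnth => i; rewrite tnth_mktuple mul0r tnth_origin.
  by apply: (slab_shift s0 r'0 e1 k01 t01 aj zs zj); rewrite -d8.
apply: (@le_trans _ _ (lebesgue_Rn n (\big[setU/set0]_(j < N) S j))).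
  apply: le_measure; rewrite ?inE.
  - exact: measurable_euclidean_ball.
  - by apply: bigsetU_measurable => j _; exact: mS.
  - move=> z zs; have := zs => /euclidean_ball0E-/(_ s0) zs'.
    have ze2 : dotp z e ^+ 2 < 1.
      apply: (le_lt_trans (dotp_sqr_le z e1)); apply: (lt_le_trans zs').
      by rewrite exprn_ile1// ltW.
    have ze : -1 < dotp z e < 1 by apply/andP; split; nra.
    (* The integer part of [q] is the index of the slab containing [z]; it is below [N] because
       [dotp z e < 1]. *)
    pose q := (dotp z e + 1) / 2 * N%:R.
    have q0 : 0 <= q by rewrite mulr_ge0// divr_ge0//; lra.
    have /andP[j1 j2] := truncn_itv q0.
    have jN : (Num.truncn q < N)%N.
      rewrite -(ltr_nat R); apply: (le_lt_trans j1).
      by rewrite /q gtr_pMl//; lra.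
    rewrite -bigcup_mkord; exists (Num.truncn q) => //; split => //=.
    have -> : dotp z e = -1 + 2 * q / N%:R by rewrite /q; field; rewrite gt_eqF.
    by rewrite in_itv/= /a lerD2l ltrD2l ler_pM2r ?ltr_pM2r ?invr_gt0// ler_pM2l//
      ltr_pM2l// j1.
have Boole := @Boole_inequality _ _ _ (lebesgue_Rn n) S N (fun j _ => mS j).
apply: (le_trans Boole).
apply: (@le_trans _ _ (\sum_(j < N) lebesgue_Rn n L)%E).
  by apply: lee_sum => j _; exact: SL.
by rewrite sumr_const card_ord mule_natl.
Qed.

End balls.

(** * The maximal function of an indicator and its measurability *)

Section maximal.
Context {R : realType}.
Local Open Scope classical_set_scope.
Local Open Scope ereal_scope.

Lemma unit_ball_measureE n (A : set (euclidean R n)) :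
  unit_ball_measure n A = lebesgue_Rn n (A `&` euclidean_ball (origin n) 1).
Proof. by []. Qed.

Lemma unit_ball_measure_fin_num n (A : set (euclidean R n)) :
  measurable A -> unit_ball_measure n A \is a fin_num.
Proof.
move=> mA; rewrite ge0_fin_numE// unit_ball_measureE.
have := @lebesgue_Rn_unit_ball_fin_num R n; rewrite ge0_fin_numE//.
apply: le_lt_trans; apply: le_measure; rewrite ?inE; last exact: subIsetr.
  by apply: measurableI => //; exact: measurable_euclidean_ball.
exact: measurable_euclidean_ball.
Qed.

Lemma le_measure_subset d (T : measurableType d) (mu : {measure set T -> \bar R})
    (A B : set T) : measurable A -> measurable B -> A `<=` B -> mu A <= mu B.
Proof. by move=> mA mB; apply: le_measure; rewrite inE. Qed.

Lemma integral_unit_ball_indic n (A B : set (euclidean R n)) :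
  measurable A -> measurable B ->
  \int[unit_ball_measure n]_(y in B) `|(\1_A y : R)%:E| = unit_ball_measure n (A `&` B).
Proof.
move=> mA mB; rewrite -integral_indic//; apply: eq_integral => y _.
by rewrite gee0_abs// lee_fin.
Qed.

(** The values are measures of the sections of the measurable subset [D] of the product space. *)
Lemma measurable_unit_ball_measure_ball n (C : set (euclidean R n)) (q : R) :
  measurable C ->
  measurable_fun setT (fun x => unit_ball_measure n (C `&` euclidean_ball x q)).
Proof.
move=> mC.
pose D : set (euclidean R n * euclidean R n) :=
  [set z | (euclidean_dist z.1 z.2 < q)%R] `&`
  (setT `*` (C `&` euclidean_ball (origin n) 1)).
have mdist : measurable_fun setT
    (fun z : euclidean R n * euclidean R n => euclidean_dist z.1 z.2 : R).
  apply: (@measurableT_comp _ _ _ _ _ _ (@Num.sqrt R)) => //.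
    apply: continuous_measurable_fun; exact: sqrt_continuous.
  apply: measurable_sum => i; apply: measurable_funX; apply: measurable_funB.
    exact: (measurableT_comp (measurable_tnth i) measurable_fst).
  exact: (measurableT_comp (measurable_tnth i) measurable_snd).
have mD : measurable D.
  apply: measurableI.
    rewrite (_ : [set z | _] = (fun z : euclidean R n * euclidean R n =>
      euclidean_dist z.1 z.2 : R) @^-1` `]-oo, q[).
      by apply: measurable_preimageT mdist _; exact: measurable_itv.
    by apply/seteqP; split => z /=; rewrite in_itv.
  apply: measurableX => //; apply: measurableI => //.
  exact: measurable_euclidean_ball.
have := measurable_fun_xsection (lebesgue_Rn n) mD.
apply: eq_measurable_fun => x _ /=; congr (lebesgue_Rn n _).
apply/seteqP; split => y; rewrite /xsection /D /=.
  by move=> /set_mem/= [xyq [_ [Cy y1]]].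
by move=> [[Cy xyq] y1]; apply/mem_set.
Qed.

Lemma euclidean_ball_bigcup n (x : euclidean R n) (r : R) :
  \bigcup_k euclidean_ball x (r - k.+1%:R^-1) = euclidean_ball x r.
Proof.
apply/seteqP; split => [y [k _]|y]; rewrite /euclidean_ball/=.
  by move=> /lt_trans; apply; rewrite ltrBlDr ltrDl invr_gt0.
move=> yr; have e0 : (0 < r - euclidean_dist x y)%R by rewrite subr_gt0.
exists (Num.bound (r - euclidean_dist x y)^-1) => //=.
rewrite ltrBrDl -ltrBrDr invf_plt ?posrE//.
have := archi_boundP (ltW (_ : (0 < (r - euclidean_dist x y)^-1)%R)).
rewrite invr_gt0 => /(_ e0) /lt_trans; apply; by rewrite ltr_nat.
Qed.

(** Clearing the denominator also disposes of the condition of positive mass: the strict inequality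
    cannot hold on a null ball. *)
Lemma maximal_fun_indic_gtP n (A : set (euclidean R n)) (l : R) (x : euclidean R n) :
  (0 < l)%R -> measurable A ->
  l%:E < maximal_fun (unit_ball_measure n) \1_A x <->
  exists2 r : R, (0 < r)%R & l%:E * unit_ball_measure n (euclidean_ball x r) <
                             unit_ball_measure n (A `&` euclidean_ball x r).
Proof.
move=> l0 mA.
have mB r : measurable (euclidean_ball x r) := measurable_euclidean_ball x r.
have aE r : unit_ball_measure n (euclidean_ball x r) =
    (fine (unit_ball_measure n (euclidean_ball x r)))%:E.
  by rewrite fineK// unit_ball_measure_fin_num.
have bE r : unit_ball_measure n (A `&` euclidean_ball x r) =
    (fine (unit_ball_measure n (A `&` euclidean_ball x r)))%:E.
  by rewrite fineK// unit_ball_measure_fin_num//; exact: measurableI.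
split.
  move=> /ereal_sup_gt[_ [r [r0 a0] <-]].
  rewrite integral_unit_ball_indic// => lr; exists r => //; move: a0 lr.
  rewrite aE bE lte_fin => a0.
  by rewrite inver gt_eqF// -!EFinM !lte_fin [X in (_ < X)%R -> _]mulrC ltr_pdivlMr.
move=> [r r0 lr]; apply/ereal_sup_gtP.
have a0 : 0 < unit_ball_measure n (euclidean_ball x r).
  rewrite lt0e measure_ge0 andbT; apply/eqP => a0.
  move: lr; rewrite a0 mule0 ltNge => /negP; apply.
  rewrite -a0; by apply: le_measure_subset; [exact: measurableI|exact: mB|exact: subIsetr].
exists ((unit_ball_measure n (euclidean_ball x r))^-1 *
  \int[unit_ball_measure n]_(y in euclidean_ball x r) `|(\1_A y : R)%:E|).
  by exists r; first by split.
rewrite integral_unit_ball_indic//; move: a0 lr.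
rewrite aE bE lte_fin => a0.
by rewrite inver gt_eqF// -!EFinM !lte_fin [X in _ -> (_ < X)%R]mulrC ltr_pdivlMr.
Qed.

(* By continuity from below, rational radii suffice. *)
Lemma measurable_maximal_fun_indic n (A : set (euclidean R n)) (l : R) :
  (0 < l)%R -> measurable A ->
  measurable [set x | l%:E < maximal_fun (unit_ball_measure n) \1_A x].
Proof.
move=> l0 mA.
have mB x r : measurable (euclidean_ball x r) := @measurable_euclidean_ball R n x r.
pose F (q : rat) : set (euclidean R n) := [set x | (0 < ratr q :> R)%R /\
  l%:E * unit_ball_measure n (euclidean_ball x (ratr q)) <
  unit_ball_measure n (A `&` euclidean_ball x (ratr q))].
rewrite (_ : [set x | _] = \bigcup_q F q).
  apply: bigcupT_measurable_rat => q.
  have [q0|q0] := @ltP _ R 0%R (ratr q); last first.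
    rewrite (_ : F q = set0)//; apply/seteqP; split => // x [].
    by rewrite ltNge q0.
  rewrite (_ : F q = setT `&` [set x |
    l%:E * unit_ball_measure n (euclidean_ball x (ratr q)) <
    unit_ball_measure n (A `&` euclidean_ball x (ratr q))]).
    apply: measurable_lte => //.
      apply: measurable_funeM.
      have := @measurable_unit_ball_measure_ball n setT (ratr q) measurableT.
      by under eq_fun do rewrite setTI.
    exact: measurable_unit_ball_measure_ball.
  by apply/seteqP; split => x [].
apply/seteqP; split => x; last first.
  by move=> [q _ [q0 lq]]; apply/maximal_fun_indic_gtP => //; exists (ratr q).
move=> /maximal_fun_indic_gtP => /(_ l0 mA) [r r0 lr].
(* Once the numerator can be taken at a smaller radius, any rational [q] between the two radii
   works: the mass of the ball only decreases and the numerator stays large enough. If [q] were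
   nonpositive, the ball would be empty and both sides zero. *)
suff [k lk] : exists k : nat, l%:E * unit_ball_measure n (euclidean_ball x r) <
    unit_ball_measure n (A `&` euclidean_ball x (r - k.+1%:R^-1)).
  have /rat_in_itvoo[q] : (r - k.+1%:R^-1 < r)%R by rewrite ltrBlDr ltrDl invr_gt0.
  rewrite in_itv/= => /andP[kq qr].
  have lq : l%:E * unit_ball_measure n (euclidean_ball x (ratr q)) <
      unit_ball_measure n (A `&` euclidean_ball x (ratr q)).
    apply: (@le_lt_trans _ _ (l%:E * unit_ball_measure n (euclidean_ball x r))).
      rewrite lee_pmul2l//; apply: le_measure_subset; [exact: mB|exact: mB|].
      by apply: subset_euclidean_ball; exact: ltW.
    apply: (lt_le_trans lk); apply: le_measure_subset; [exact: measurableI|exact: measurableI|].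
    by apply: setIS; apply: subset_euclidean_ball; exact: ltW.
  exists q => //; split => //; rewrite ltNge; apply/negP => q0.
  move: lq; rewrite (_ : euclidean_ball x (ratr q) = set0).
    by rewrite setI0 !measure0 mule0 ltxx.
  apply/seteqP; split => // y; rewrite /euclidean_ball/=.
  by rewrite ltNge (le_trans q0)// sqrtr_ge0.
(* Otherwise the bound [l%:E * unit_ball_measure n (euclidean_ball x r)] would hold for all the
   smaller balls, hence for their increasing union, contradicting [lr]. *)
apply: contrapT => /forallNP noK.
have := @nondecreasing_cvg_mu _ _ _ (unit_ball_measure n)
  (fun k => A `&` euclidean_ball x (r - k.+1%:R^-1)).
rewrite -setI_bigcupr euclidean_ball_bigcup => cvg_mu.
have {}cvg_mu := cvg_mu (fun k => measurableI _ _ mA (mB _ _)) (measurableI _ _ mA (mB _ _)).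
have /cvg_mu {}cvg_mu : {homo (fun k => A `&` euclidean_ball x (r - k.+1%:R^-1)) :
    i j / (i <= j)%N >-> (i <= j)%O}.
  move=> i j ij; apply/subsetPset; apply: setIS; apply: subset_euclidean_ball.
  by rewrite lerB// lef_pV2 ?posrE// ler_nat.
move: lr; rewrite ltNge => /negP; apply.
rewrite -(cvg_lim _ cvg_mu)//; apply: lime_le; first by apply/cvg_ex; eexists; exact: cvg_mu.
by apply: nearW => k; rewrite leNgt; apply/negP; exact: noK.
Qed.

End maximal.

(** * Choice of the radii *)

Section parameters.
Context {R : realType}.

(** Combines [ln (1 - u) <= - u] with [1 + a * u <= expR (a * u)]. *)
Lemma powR_1B_le (u a : R) : 0 <= u < 1 -> 0 <= a ->
  (1 - u) `^ a <= (1 + a * u)^-1.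
Proof.
move=> /andP[u0 u1] a0; have u1' : 0 < 1 - u by rewrite subr_gt0.
rewrite /powR gt_eqF// -[leRHS]invrK invrK.
have lnu : ln (1 - u) <= - u by have := @le_ln1Dx R (- u); rewrite ltrN2; apply.
apply: (@le_trans _ _ (expR (- (a * u)))).
  by rewrite ler_expR -mulrN ler_wpM2l.
rewrite expRN lef_pV2 ?posrE ?expR_gt0//; last by rewrite ltr_wpDr ?mulr_ge0.
exact: expR_ge1Dx.
Qed.

(* With [r ^ 2 = 1 - 2 * u], this is [(rho * r `^ p^-1) ^ 2 < s ^ 2] for the limiting
   radii [rho ^ 2 = 1 - h ^ 2] and [s ^ 2 = r ^ 2 - (h - u) ^ 2]. It holds for
   [h = p / 2] and small [u] because both sides agree at [u = 0] and [p / 2 > p - 1]. *)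
Lemma exists_lens_gap (p : R) : 1 <= p < 2 ->
  exists h u : R, [/\ 1 / 2 <= h < 1, 0 < u <= 1 / 12 &
    (1 - h ^+ 2) * (1 - 2 * u) `^ p^-1 < 1 - 2 * u - (h - u) ^+ 2].
Proof.
move=> /andP[p1 p2].
have p0 : 0 < p by lra.
pose a := p^-1; have ap : a * p = 1 by rewrite mulVf// gt_eqF.
have a0 : 0 < a by rewrite invr_gt0.
have a1 : a <= 1 by rewrite invf_le1.
pose h := p / 2; have h0 : 1 / 2 <= h by rewrite /h; lra.
have h1 : h < 1 by rewrite /h; lra.
have ph : p = 2 * h by rewrite /h; lra.
have ah : a * h = 1 / 2 by rewrite ph in ap; lra.
have aE : a = 1 / (2 * h) by rewrite /a ph div1r.
rewrite -[p^-1]/a; clearbody a h.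
(* [K] is the coefficient of [u] in [(1 - 2 * u - (h - u) ^ 2) * (1 + 2 * a * u)], simplified by
   [2 * a * h = 1]. The remaining terms cost at most [5 * u ^ 2], so [u = K / 6] keeps the gain
   positive. *)
pose K := 2 * (1 - h) ^+ 2 * a.
have K0 : 0 < K.
  apply: mulr_gt0 => //; apply: mulr_gt0 => //.
  by apply: exprn_gt0; lra.
have K1 : K <= 1 / 2.
  have q1 : (1 - h) ^+ 2 <= 1 / 4 by nra.
  by have := sqr_ge0 (1 - h); rewrite /K; nra.
pose u := K / 6; have u0 : 0 < u by rewrite /u; lra.
have u1 : u <= 1 / 12 by rewrite /u; lra.
have B0 : 0 < 1 - h ^+ 2 by nra.
exists h, u; split; [by rewrite h0 h1|by rewrite u0 u1|].
apply: (@le_lt_trans _ _ ((1 - h ^+ 2) / (1 + a * (2 * u)))).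
  by rewrite ler_pM2l//; apply: powR_1B_le; lra.
have den : 0 < 1 + a * (2 * u) by nra.
rewrite ltr_pdivrMr//.
have -> : (1 - 2 * u - (h - u) ^+ 2) * (1 + a * (2 * u)) =
    1 - h ^+ 2 + u * (K - u * (1 + 4 * (a - a * h) + 2 * a * u)).
  by rewrite /K aE; field; lra.
rewrite ltrDl mulr_gt0// ah.
have : u * (1 + 4 * (a - 1 / 2) + 2 * a * u) <= u * 5.
  by rewrite ler_pM2l//; nra.
by rewrite /u; lra.
Qed.

(** The gap is strict, so the limiting values [A] of [s ^ 2] and [B] of [rho ^ 2] can be moved by a
    small [e], which leaves room for slabs of positive width and for a shell of positive
    thickness. *)
Lemma exists_parameters (p : R) : 1 <= p < 2 ->
  exists (h k r t0 s rho R0 : R) (N : nat),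
   [/\ [/\ 0 < h < 1, 0 <= k <= t0, 0 < r <= 1 & 0 < t0 < 1],
       [/\ 0 < s <= 1, 0 < rho, 0 < R0, R0 ^+ 2 = 2 - 2 * h & (0 < N)%N],
       [/\ (1 - h) * (1 + 2 * h - h * t0 ^+ 2) <= rho ^+ 2,
           s ^+ 2 + k ^+ 2 + 8 / N%:R <= r ^+ 2 &
           s ^+ 2 + (1 - k) ^+ 2 + 8 / N%:R <= R0 ^+ 2] &
       1 < s / (rho * r `^ p^-1)].
Proof.
move=> p12; have [h [u [/andP[h0 h1] /andP[u0 u1] gap]]] := exists_lens_gap p12.
have p0 : 0 < p by move: p12 => /andP[/(lt_le_trans ltr01)].
have u2 : 0 < 1 - 2 * u by lra.
(* For [normsq x = 1], the spheres of squared radii [1 - 2 * u] about [0] and [2 - 2 * h] about [x]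
   meet in the hyperplane at distance [h - u]; hence [A + (1 - k) ^ 2 = 2 - 2 * h]. *)
pose k := h - u.
pose A := 1 - 2 * u - k ^+ 2.
pose B := 1 - h ^+ 2.
have B0 : 0 < B by rewrite /B; nra.
pose r := Num.sqrt (1 - 2 * u).
have r2 : r ^+ 2 = 1 - 2 * u by rewrite sqr_sqrtr// ltW.
have r0 : 0 < r by rewrite sqrtr_gt0.
have r1 : r <= 1 by rewrite -(@ler_pXn2r _ 2) ?nnegrE ?(ltW r0)// r2; lra.
pose G := (r `^ p^-1) ^+ 2.
have G0 : 0 < G by rewrite exprn_gt0// powR_gt0.
have GE : G = (1 - 2 * u) `^ p^-1.
  by rewrite /G -r2 expr2 -powRM ?(ltW r0)// -expr2.
have G1' : G <= 1.
  rewrite GE; apply: (@le_trans _ _ (1 `^ p^-1)); last by rewrite powR1.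
  by apply: ge0_ler_powR; rewrite ?nnegrE ?invr_ge0//; lra.
rewrite -GE -/k -/A -/B in gap.
(* A quarter of the gap: as [G <= 1], the two perturbations together cost at most [2 * e]. *)
pose e := (A - B * G) / 4; have e0 : 0 < e by rewrite /e; lra.
have Ae : (B + e) * G < A - e.
  have : e * G <= e by rewrite ler_piMr// ltW.
  by rewrite mulrDl /e; lra.
have Ae0 : 0 < A - e by apply: lt_trans Ae; rewrite mulr_gt0// addr_gt0.
have Be : 0 < B + e by rewrite addr_gt0.
have A1 : A <= 1 by rewrite /A; have := sqr_ge0 k; lra.
pose N := Num.bound (8 / e).
have N8 : 8 / e < N%:R by apply: archi_boundP; rewrite divr_ge0// ltW.
have N0 : (0 : R) < N%:R by apply: lt_trans N8; rewrite divr_gt0.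
have N8e : 8 / N%:R <= e.
  by rewrite ler_pdivrMr// mulrC -ler_pdivrMr// ltW.
(* The bound [1 - e] makes [1 - t0 ^ 2] at most [2 * e]; the bound [h] ensures [k <= t0]. *)
pose t0 := Num.max h (1 - e).
have t0h : h <= t0 by rewrite le_max lexx.
have t0e : 1 - e <= t0 by rewrite le_max lexx orbT.
have t01 : t0 < 1 by rewrite gt_max h1; lra.
exists h, k, r, t0, (Num.sqrt (A - e)), (Num.sqrt (B + e)), (Num.sqrt (2 - 2 * h)), N.
have sA : Num.sqrt (A - e) ^+ 2 = A - e by rewrite sqr_sqrtr// ltW.
have sB : Num.sqrt (B + e) ^+ 2 = B + e by rewrite sqr_sqrtr// ltW.
have sR : Num.sqrt (2 - 2 * h) ^+ 2 = 2 - 2 * h by rewrite sqr_sqrtr//; lra.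
split; [split| split | split |].
- by apply/andP; split; lra.
- by apply/andP; split; rewrite /k; lra.
- by rewrite r0 r1.
- by apply/andP; split; lra.
- by rewrite sqrtr_gt0 Ae0 -[leRHS]sqrtr1 ler_sqrt//; lra.
- by rewrite sqrtr_gt0; lra.
- by rewrite sqrtr_gt0; lra.
- by [].
- by rewrite -(ltr0n R).
- rewrite sB /B.
  have : (1 - h) * (1 + 2 * h - h * t0 ^+ 2) =
    1 - h ^+ 2 + h * (1 - h) * (1 - t0 ^+ 2) by ring.
  move=> ->; rewrite lerD2l.
  have t2 : 0 <= 1 - t0 ^+ 2 <= 2 * e by apply/andP; split; nra.
  have : h * (1 - h) <= 1 / 4 by nra.
  have : 0 <= h * (1 - h) by nra.
  move: t2 => /andP[]; nra.
- by rewrite sA r2 /A; lra.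
- by rewrite sA sR /A /k; lra.
- rewrite ltr_pdivlMr ?mul1r ?mulr_gt0 ?powR_gt0 ?sqrtr_gt0//.
  rewrite -(@ltr_pXn2r _ 2) ?nnegrE ?mulr_ge0 ?sqrtr_ge0 ?powR_ge0//.
  by rewrite exprMn sA sB.
Qed.

End parameters.

(** * The lower bound for weak-type constants *)

Section lower_bound.
Context {R : realType}.
Local Open Scope classical_set_scope.

Lemma Lnorm_indic d (T : measurableType d) (mu : {measure set T -> \bar R})
    (A : set T) (p : R) : 0 < p -> measurable A ->
  ('N[mu]_p%:E[EFin \o (\1_A : T -> R)] = mu A `^ p^-1)%E.
Proof.
move=> p0 mA; rewrite unlock /=; congr (_ `^ _)%E.
rewrite -[in RHS](setIT A) -(integral_indic mu measurableT mA).
apply: eq_integral => x _; rewrite /= indicE.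
by case: (x \in A); rewrite ?normr1 ?powR1 ?normr0 ?powR0// gt_eqF.
Qed.

Lemma indic_Lfun d (T : measurableType d) (mu : {measure set T -> \bar R})
    (A : set T) (p : R) : 0 < p -> measurable A -> mu A \is a fin_num ->
  (\1_A : T -> R) \in Lfun mu p%:E.
Proof.
move=> p0 mA Afin; rewrite inE; apply/andP; split.
  by rewrite inE/=; exact: measurable_indic.
by rewrite inE/= /finite_norm Lnorm_indic// poweR_lty// -ge0_fin_numE.
Qed.

Lemma scalevK n (x : euclidean R n) (t : R) : t != 0 ->
  scalev t (scalev t^-1 x) = x.
Proof.
move=> t0; apply: eq_from_tnth => i.
by rewrite !tnth_mktuple mulrA mulfV// mul1r.
Qed.

Lemma normsq_scalev n (x : euclidean R n) (t : R) :
  normsq (scalev t x) = t ^+ 2 * normsq x.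
Proof.
by rewrite /normsq mulr_sumr; apply: eq_bigr => i _; rewrite tnth_mktuple exprMn.
Qed.

Section radii.
Variables (n : nat) (h k r t0 s rho R0 : R) (N : nat).
Hypotheses (h01 : 0 < h < 1) (kt0 : 0 <= k <= t0) (r01 : 0 < r <= 1).
Hypotheses (t01 : 0 < t0 < 1) (s01 : 0 < s <= 1) (rho0 : 0 < rho).
Hypotheses (R00 : 0 < R0) (R0E : R0 ^+ 2 = 2 - 2 * h) (N0 : (0 < N)%N).
Hypotheses (rhoE : (1 - h) * (1 + 2 * h - h * t0 ^+ 2) <= rho ^+ 2).
Hypotheses (sr : s ^+ 2 + k ^+ 2 + 8 / N%:R <= r ^+ 2).
Hypotheses (sR0 : s ^+ 2 + (1 - k) ^+ 2 + 8 / N%:R <= R0 ^+ 2).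

(** Half of the lower bound [s ^ n / (N * rho ^ n)] for the average over [B(x, R0)]; the factor [2]
    makes the inequality strict. *)
Let level : R := s ^+ n / (2 * N%:R * rho ^+ n).

Let NR0 : (0 : R) < N%:R. Proof. by rewrite ltr0n. Qed.
Let r0 : 0 < r. Proof. by case/andP: r01. Qed.
Let s0 : 0 < s. Proof. by case/andP: s01. Qed.
Let t00 : 0 < t0. Proof. by case/andP: t01. Qed.

Lemma level_gt0 : 0 < level.
Proof. by rewrite /level divr_gt0 ?mulr_gt0 ?mulr_gt0 ?exprn_gt0. Qed.

(** The ball [B(x, R0)] is the witness: [ball_cap_subset] bounds its mass from above, [ball_le_lens]
    bounds the lens from below. *)
Lemma maximal_fun_ball_gt (x : euclidean R n) : t0 ^+ 2 <= normsq x < 1 ->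
  (level%:E < maximal_fun (unit_ball_measure n) \1_(euclidean_ball (origin n) r) x)%E.
Proof.
move=> /andP[xt0 x1].
have mB y q : measurable (euclidean_ball y q) := @measurable_euclidean_ball R n y q.
apply/maximal_fun_indic_gtP; [exact: level_gt0|exact: mB|exists R0 => //].
pose t := Num.sqrt (normsq x).
have t2 : t ^+ 2 = normsq x by rewrite sqr_sqrtr// normsq_ge0.
have t0t : t0 <= t by rewrite -(@ler_pXn2r _ 2) ?nnegrE ?sqrtr_ge0 ?(ltW t00)// t2.
have t1 : t < 1 by rewrite -(@ltr_pXn2r _ 2) ?nnegrE ?sqrtr_ge0// t2 expr1n.
have tgt0 : 0 < t by exact: lt_le_trans t0t.
have [k0 kt0'] := andP kt0.
have lens : (lebesgue_Rn n (euclidean_ball (origin n) s) <= N%:R%:E *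
    lebesgue_Rn n (euclidean_ball (origin n) r `&` euclidean_ball x R0))%E.
  have e1 : normsq (scalev t^-1 x) = 1.
    by rewrite normsq_scalev -t2 exprVn mulVf// expf_neq0// gt_eqF.
  have k01 : 0 <= k <= 1 by rewrite k0 (le_trans kt0')// (le_trans t0t)// ltW.
  have t'01 : 0 <= t <= 1 by rewrite !ltW.
  have := @ball_le_lens R n (scalev t^-1 x) N s k t r R0 e1 N0 s01 k01 t'01 r0 R00 sr.
  (* Here [x = t e] with [e] the unit vector along [x]. Since [k <= t0 <= t < 1],
     [(k - t) ^ 2 <= (1 - k) ^ 2], so the condition stated for [t = 1] suffices. *)
  rewrite scalevK ?gt_eqF//; apply; apply: le_trans sR0.
  by rewrite lerD2r lerD2l -sqrrN opprB; nra.
have cap : (unit_ball_measure n (euclidean_ball x R0) <=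
    (rho ^+ n * ball_volume n)%:E)%E.
  rewrite -(lebesgue_Rn_ballE (scalev h x) rho0) unit_ball_measureE.
  apply: le_measure_subset; [exact: measurableI|exact: mB|].
  exact: ball_cap_subset R0E xt0 rhoE.
have AE : unit_ball_measure n (euclidean_ball (origin n) r `&` euclidean_ball x R0) =
    lebesgue_Rn n (euclidean_ball (origin n) r `&` euclidean_ball x R0).
  rewrite unit_ball_measureE; congr (lebesgue_Rn n _); apply/setIidl.
  apply: subset_trans (@subIsetl _ _ _) _; apply: subset_euclidean_ball.
  by case/andP: r01.
have Afin := unit_ball_measure_fin_num (measurableI _ _ (mB (origin n) r) (mB x R0)).
rewrite -AE -(fineK Afin) lebesgue_Rn_ballE// -EFinM lee_fin in lens.
rewrite -(fineK Afin).
apply: (@le_lt_trans _ _ (level%:E * (rho ^+ n * ball_volume n)%:E)%E).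
  by rewrite lee_pmul2l// lte_fin level_gt0.
rewrite -EFinM lte_fin.
have -> : level * (rho ^+ n * ball_volume n) = s ^+ n * ball_volume n / N%:R / 2.
  by rewrite /level; field; rewrite !gt_eqF ?exprn_gt0.
have v0 : 0 < s ^+ n * ball_volume n / N%:R.
  by rewrite divr_gt0 ?mulr_gt0 ?exprn_gt0 ?ball_volume_gt0.
apply: (@lt_le_trans _ _ (s ^+ n * ball_volume n / N%:R)); first by lra.
by rewrite ler_pdivrMr// [leRHS]mulrC.
Qed.

(** The level set contains the shell between the radii [t0] and [1], of volume
    [(1 - t0 ^+ n) * ball_volume n], and [t0 ^+ n <= t0] for [n >= 1]. *)
Lemma level_set_measure_ge : (1 <= n)%N ->
  (((1 - t0) * ball_volume n)%:E <= unit_ball_measure n [set x |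
     level%:E < maximal_fun (unit_ball_measure n) \1_(euclidean_ball (origin n) r) x])%E.
Proof.
move=> n1.
have mB q : measurable (euclidean_ball (origin n) q) := measurable_euclidean_ball _ q.
have t01' : t0 <= 1 by case/andP: t01 => _ /ltW.
apply: (@le_trans _ _
    (lebesgue_Rn n (euclidean_ball (origin n) 1 `\` euclidean_ball (origin n) t0))).
  have -> : lebesgue_Rn n (euclidean_ball (origin n) 1 `\` euclidean_ball (origin n) t0) =
      (lebesgue_Rn n (euclidean_ball (origin n) 1) -
       lebesgue_Rn n (euclidean_ball (origin n) 1 `&` euclidean_ball (origin n) t0))%E.
    apply: measureD; [exact: mB|exact: mB|].
    have : (lebesgue_Rn n (euclidean_ball (@origin R n) 1) < +oo)%E.
      by rewrite lebesgue_Rn_ballE// ltry.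
    exact.
  rewrite setIidr; last exact: subset_euclidean_ball.
  rewrite !lebesgue_Rn_ballE// -EFinB lee_fin expr1n -mulrBl.
  rewrite ler_pM2r ?ball_volume_gt0// lerB// -[leRHS]expr1.
  by rewrite ler_wiXn2l// ltW.
rewrite unit_ball_measureE; apply: le_measure_subset.
- exact: measurableD.
- apply: measurableI => //.
  by apply: measurable_maximal_fun_indic; [exact: level_gt0|exact: mB].
- move=> x [x1 xt0]; split=> //=; apply: maximal_fun_ball_gt.
  move/euclidean_ball0E : x1 => /(_ ltr01); rewrite expr1n => ->.
  rewrite andbT leNgt; apply/negP => xlt; apply: xt0.
  by apply/euclidean_ball0E.
Qed.

(** The weak-type inequality is tested on the indicator of [B(0, r)] at height [level]; the factor
    [ball_volume n] to the power [p^-1] appears on both sides and cancels. *)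
Lemma weak_type_bound_ge (p c : R) : 1 <= p -> (1 <= n)%N ->
  weak_type_bound (unit_ball_measure n) p c ->
  (1 - t0) `^ p^-1 / (2 * N%:R) * (s / (rho * r `^ p^-1)) ^+ n <= c.
Proof.
move=> p1 n1 wc; have p0 : 0 < p by exact: lt_le_trans p1.
have mB : measurable (euclidean_ball (origin n) r) := measurable_euclidean_ball _ r.
have vn0 := ball_volume_gt0 (R := R) n.
have rE : unit_ball_measure n (euclidean_ball (origin n) r) = (r ^+ n * ball_volume n)%:E.
  rewrite unit_ball_measureE setIidl ?lebesgue_Rn_ballE//.
  by apply: subset_euclidean_ball; case/andP: r01.
have := wc level (\1_(euclidean_ball (origin n) r)) level_gt0.
rewrite Lnorm_indic// rE => weak.
have {}weak := weak (indic_Lfun p0 mB (unit_ball_measure_fin_num mB)).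
have : (((1 - t0) * ball_volume n)%:E `^ p^-1 <=
    (c / level)%:E * (r ^+ n * ball_volume n)%:E `^ p^-1)%E.
  apply: le_trans weak; apply: gt0_ler_poweR.
  - by rewrite invr_ge0 ltW.
  - rewrite in_itv/= leey andbT lee_fin mulr_ge0 ?(ltW vn0)// subr_ge0 ltW//.
    by case/andP: t01.
  - by rewrite in_itv/= leey andbT measure_ge0.
  - exact: level_set_measure_ge.
have t1 : 0 <= 1 - t0 by rewrite subr_ge0 ltW//; case/andP: t01.
rewrite !poweR_EFin -EFinM lee_fin !powRM ?exprn_ge0 ?(ltW vn0) ?(ltW r0)//.
rewrite mulrA ler_pM2r ?powR_gt0// => le_c.
have rn0 : 0 < (r ^+ n) `^ p^-1 by rewrite powR_gt0// exprn_gt0.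
rewrite -ler_pdivrMr// ler_pdivlMr ?level_gt0// in le_c.
apply: le_trans le_c; rewrite le_eqVlt; apply/orP; left; apply/eqP.
have -> : (r ^+ n) `^ p^-1 = (r `^ p^-1) ^+ n.
  by rewrite -powR_mulrn ?(ltW r0)// -powRrM mulrC powRrM powR_mulrn// powR_ge0.
rewrite /level expr_div_n exprMn; field.
by rewrite !gt_eqF ?exprn_gt0 ?powR_gt0.
Qed.

End radii.

End lower_bound.

Theorem theorem2p1 (R : realType) (p : R) (hp : 1 <= p < 2) :
  exists a_p c_p : R, 1 < a_p /\ 0 < c_p /\
    forall n : nat, (1 <= n)%N ->
      ((c_p * a_p ^+ n)%:E < best_constant (unit_ball_measure (R := R) n) p)%E.
Proof.
have [h [k [r [t0 [s [rho [R0 [N [[h01 kt0 r01 t01]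
  [s01 rho0 R00 R0E N0] [rhoE sr sR0] q1]]]]]]]]] := exists_parameters hp.
have C0 : 0 < (1 - t0) `^ p^-1 / (2 * N%:R).
  rewrite divr_gt0 ?mulr_gt0 ?ltr0n// powR_gt0// subr_gt0.
  by case/andP: t01.
(* The extra division by [2] turns the lower bound for all admissible constants into a strict one
   for their infimum. *)
exists (s / (rho * r `^ p^-1)), ((1 - t0) `^ p^-1 / (2 * N%:R) / 2).
split=> //; split=> [|n n1]; first by rewrite divr_gt0.
have qn0 : 0 < (s / (rho * r `^ p^-1)) ^+ n.
  by rewrite exprn_gt0// (lt_trans ltr01).
apply: (@lt_le_trans _ _
  ((1 - t0) `^ p^-1 / (2 * N%:R) * (s / (rho * r `^ p^-1)) ^+ n)%:E).
  by rewrite lte_fin ltr_pM2r// ltr_pdivrMr// ltr_pMr// ltr1n.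
apply: le_ereal_inf_tmp => _ [c [_ wc] <-]; rewrite lee_fin.
have /andP[p1 _] := hp.
exact: (weak_type_bound_ge h01 kt0 r01 t01 s01 rho0 R00 R0E N0 rhoE sr sR0 p1 n1 wc).
Qed.
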